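(* Let $J:\mathbb{R}^{n+1}\to\mathbb{R}$ satisfy: $\operatorname{supp}J\subset\mathbb{R}^{n+1}_+$; $J\ge 0$; $J\in L^1(\mathbb{R}^{n+1})$ with $\iint_{\mathbb{R}^{n+1}}J(x,t)\,dx\,dt=1$; and $J$ has compact support in $\mathbb{R}^{n+1}$. Set $\alpha=\sup\{\beta:\iint_{s\le\beta}J(y,s)\,dy\,ds<1\}$. Let $w(x,t)$ be a bounded measurable function defined in $\mathbb{R}^{n+1}_+$ such that $$w(x,t)=\iint J(x-y,t-s)\,w(y,s)\,dy\,ds$$ for $(x,t)\in\mathbb{R}^n\times[\alpha,+\infty)$. Then $$\sup_{(x,t)\in\mathbb{R}^{n+1}_+}|w(x,t)|=\sup_{(x,t)\in\mathbb{R}^n\times[0,\alpha]}|w(x,t)|.$$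
   Context: $\mathbb{R}^{n+1}_+=\{(x,t):x\in\mathbb{R}^n,\ t\ge 0\}$. In the integral identity for $w$ the integration is over $(y,s)\in\mathbb{R}^{n+1}_+$, where $w$ is defined; for $t\ge\alpha$ the function $(y,s)\mapsto J(x-y,t-s)$ vanishes almost everywhere outside $\mathbb{R}^{n+1}_+$. *)

(* Defs.v *)
From HB Require Import structures.
From mathcomp Require Import all_boot all_order all_algebra.
From mathcomp Require Import all_classical all_reals all_analysis.

Set Implicit Arguments.
Unset Strict Implicit.
Unset Printing Implicit Defensive.

Import Order.TTheory GRing.Theory Num.Theory.
Import numFieldNormedType.Exports.

Local Open Scope classical_set_scope.
Local Open Scope ring_scope.

(* The Borel sigma-algebra of R^n, generated by the coordinate projections
   (the same construction as the library's instance on n.-tuple T). *)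
Definition rV_display : measure_display -> measure_display.
Proof. exact. Qed.

Section measurable_rV.
Context {d} {T : measurableType d} (n : nat).

Let coor : 'I_n -> 'rV[T]_n -> T := fun i v => v ord0 i.

HB.instance Definition _ := @isMeasurable.Build (rV_display d) 'rV[T]_n
  (g_sigma_preimage coor) (@sigma_algebra0 _ _ _) (@sigma_algebraC _ _)
  (@sigma_algebra_bigcup _ _ _).

End measurable_rV.

Lemma measurable_coord_rV d (T : measurableType d) n (i : 'I_n) :
  measurable_fun [set: 'rV[T]_n] (fun v => v ord0 i).
Proof.
move=> _ Y mY; rewrite setTI; apply: sub_sigma_algebra => /=.
rewrite -bigcup_seq/=; exists i => /=; first by rewrite mem_index_enum.
by exists Y => //; rewrite setTI.
Qed.

Lemma measurable_fun_rVP d (T : measurableType d) d' (T' : measurableType d')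
    n (f : T' -> 'rV[T]_n) :
  (forall i, measurable_fun [set: T'] (fun x => f x ord0 i)) ->
  measurable_fun [set: T'] f.
Proof.
move=> mf _ A mA; rewrite setTI.
apply: (mA [set B | measurable (f @^-1` B)]); split.
  split => [|B mB|F mF] /=.
  - by rewrite preimage_set0.
  - by rewrite setTD preimage_setC; exact: measurableC.
  - by rewrite preimage_bigcup; exact: bigcupT_measurable.
move=> B; rewrite -bigcup_seq/= => -[i _ [C mC <-]].
by rewrite setTI; have := mf i measurableT C mC; rewrite setTI.
Qed.

(* The instance found by inference on m1 \x m2 is the one for products of
   subprobabilities, which does not apply to Lebesgue measure. *)
Lemma sigma_finite_prod d1 d2 (T1 : measurableType d1) (T2 : measurableType d2)
    (R : realType) (m1 : {sigma_finite_measure set T1 -> \bar R})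
    (m2 : {sigma_finite_measure set T2 -> \bar R}) :
  sigma_finite setT (m1 \x m2)%E.
Proof.
have /sigma_finiteP[F [TF ndF Foo]] := sigma_finiteT m1.
have /sigma_finiteP[G [TG ndG Goo]] := sigma_finiteT m2.
exists (fun n => F n `*` G n).
  rewrite -setXTT TF TG predeqE => -[x y]; split.
    move=> [/= [n _ Fnx] [k _ Gky]]; exists (maxn n k) => //; split.
    - by move: x Fnx; exact/subsetPset/ndF/leq_maxl.
    - by move: y Gky; exact/subsetPset/ndG/leq_maxr.
  by move=> [n _ []/= ? ?]; split; exists n.
move=> k; have [? ?] := Foo k; have [? ?] := Goo k.
split; first exact: measurableX.
by rewrite product_measure1E// lte_mul_pinfty// ge0_fin_numE.
Qed.

Section lebesgue_rV.
Context {R : realType}.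
Local Open Scope ereal_scope.
Local Notation mR := (measurableTypeR R).

Definition cons_rV n (p : mR * 'rV[R]_n) : 'rV[R]_n.+1 :=
  row_mx p.1%:M p.2.

Lemma cons_rV0 n (p : mR * 'rV[R]_n) : cons_rV p ord0 ord0 = p.1.
Proof.
rewrite /cons_rV (_ : ord0 = lshift n (ord0 : 'I_1)); last exact/val_inj.
by rewrite ord1 (@row_mxEl _ 1 1 n) mxE.
Qed.

Lemma cons_rVS n (p : mR * 'rV[R]_n) i :
  cons_rV p ord0 (lift ord0 i) = p.2 ord0 i.
Proof.
rewrite /cons_rV (_ : lift ord0 i = rshift 1 i); last exact/val_inj.
by rewrite (@row_mxEr _ 1 1 n).
Qed.

Lemma measurable_cons_rV n : measurable_fun [set: mR * 'rV[R]_n] (@cons_rV n).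
Proof.
apply: measurable_fun_rVP => i; case: (unliftP ord0 i) => [j|] ->.
  rewrite (_ : (fun _ => _) = (fun v : 'rV[R]_n => v ord0 j) \o snd).
    by apply: measurableT_comp => //; exact: measurable_coord_rV.
  by apply/funext => p; rewrite cons_rVS.
by rewrite (_ : (fun _ => _) = fst)//; apply/funext => p; rewrite cons_rV0.
Qed.

HB.instance Definition _ n :=
  @isMeasurableFun.Build _ _ _ _ (@cons_rV n) (@measurable_cons_rV n).

Lemma measurable_uncons_rV n :
  measurable_fun [set: 'rV[R]_n.+1]
    (fun v => (v ord0 ord0 : mR, rsubmx (v : 'rV[R]_(1 + n)))).
Proof.
apply/measurable_fun_pairP; split => /=; first exact: measurable_coord_rV.
apply: measurable_fun_rVP => i.
rewrite (_ : (fun _ => _) = fun v : 'rV[R]_n.+1 => v ord0 (rshift 1 i)).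
  exact: measurable_coord_rV.
by apply/funext => v; rewrite mxE.
Qed.

Section step.
Context n (m : {sigma_finite_measure set 'rV[R]_n -> \bar R}).

Definition lebesgue_rV_step : set 'rV[R]_n.+1 -> \bar R :=
  pushforward (lebesgue_measure \x m) (@cons_rV n).

Let step0 : lebesgue_rV_step set0 = 0.
Proof. by rewrite /lebesgue_rV_step /pushforward preimage_set0 measure0. Qed.

Let step_ge0 A : 0 <= lebesgue_rV_step A.
Proof. exact: (measure_ge0 (lebesgue_measure \x m)). Qed.

Let step_sigma_additive : semi_sigma_additive lebesgue_rV_step.
Proof. exact: measure_semi_sigma_additive. Qed.

HB.instance Definition _ := isMeasure.Build _ _ _ lebesgue_rV_step
  step0 step_ge0 step_sigma_additive.

Let step_sigma_finite : sigma_finite setT lebesgue_rV_step.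
Proof.
have [F TF Foo] := sigma_finite_prod lebesgue_measure m.
pose g (v : 'rV[R]_n.+1) :=
  (v ord0 ord0 : mR, rsubmx (v : 'rV[R]_(1 + n))).
exists (fun k => g @^-1` F k).
  by rewrite -preimage_bigcup -TF preimage_setT.
move=> k; have [mF Fk] := Foo k; split.
  by rewrite -[X in measurable X]setTI; exact: measurable_uncons_rV.
rewrite /lebesgue_rV_step /pushforward -comp_preimage.
rewrite (_ : g \o _ = id)//; apply/funext => -[x v]/=.
by rewrite /g cons_rV0 /cons_rV row_mxKr.
Qed.

HB.instance Definition _ := Measure_isSigmaFinite.Build _ _ _ lebesgue_rV_step
  step_sigma_finite.

End step.

Fixpoint lebesgue_rV n : {sigma_finite_measure set 'rV[R]_n -> \bar R} :=
  if n is n'.+1 then lebesgue_rV_step (lebesgue_rV n')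
  else dirac (0%R : 'rV[R]_0).

Lemma measurable_box n (A : 'I_n -> set mR) : (forall i, measurable (A i)) ->
  measurable [set v : 'rV[R]_n | forall i, A i (v ord0 i)].
Proof.
move=> mA.
rewrite (_ : [set v | _] =
    \bigcap_(i in [set: 'I_n]) ((fun v : 'rV[R]_n => v ord0 i) @^-1` A i)).
  apply: fin_bigcap_measurable => [|i _]; first exact: finite_finset.
  rewrite -[X in measurable X]setTI.
  exact: (measurable_coord_rV i measurableT (mA i)).
by apply/seteqP; split => v /= + i => /(_ i); [|apply].
Qed.

Lemma lebesgue_rV_box n (A : 'I_n -> set mR) : (forall i, measurable (A i)) ->
  lebesgue_rV n [set v | forall i, A i (v ord0 i)] =
  \prod_(i < n) lebesgue_measure (A i).
Proof.
elim: n A => [|n ih] A mA.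
  by rewrite big_ord0 /= diracE mem_set//=; case.
rewrite big_ord_recl /= -ih// -product_measure1E//; last first.
  exact: (measurable_box (fun i => mA (lift ord0 i))).
rewrite /lebesgue_rV_step /pushforward; congr (_ _).
apply/seteqP; split => -[x v] /=.
  move=> h; split=> [|i]; first by have := h ord0; rewrite cons_rV0.
  by have := h (lift ord0 i); rewrite cons_rVS.
move=> [h0 h] i; case: (unliftP ord0 i) => [j|] ->; first by rewrite cons_rVS.
by rewrite cons_rV0.
Qed.

Definition borel_lebesgue n : {measure set ('rV[R]_n * mR) -> \bar R} :=
  (lebesgue_rV n \x lebesgue_measure)%E.

(* The points (x, t) of R^{n+1} with their Lebesgue-measurable sets (the
   completion of the Borel sets) as measurable structure. *)
Definition spacetime n := caratheodory_type ((borel_lebesgue n)^*)%mu.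
HB.instance Definition _ n := Measurable.on (spacetime n).

Definition lebesgue_spacetime n : {measure set (spacetime n) -> \bar R} :=
  @completed_measure_extension _ _ _ (borel_lebesgue n).

End lebesgue_rV.
Arguments spacetime : clear implicits.

Section definitions.
Context {R : realType} {n : nat}.
Local Notation mu := (@lebesgue_spacetime R n).
Implicit Types f J : 'rV[R]_n * R -> R.

Definition lebesgue_measurable (D : set ('rV[R]_n * R)) f :=
  measurable_fun (D : set (spacetime R n)) (f : spacetime R n -> R).

(* Pointwise topological support, in the product topology of R^n x R. *)
Definition supp f := closure [set z | f z != 0].

Definition halfspace : set ('rV[R]_n * R) := [set z | 0 <= z.2].

Definition alpha J : R :=
  sup [set b | (\int[mu]_(z in [set z | (z.2 <= b)%R]) (J z)%:E < 1)%E].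

End definitions.

(* Main.v *)
Require Import Defs.
From HB Require Import structures.
From mathcomp Require Import all_boot all_order all_algebra.
From mathcomp Require Import all_classical all_reals all_analysis.
From mathcomp Require Import measurable_realfun lra.

Set Implicit Arguments.
Unset Strict Implicit.
Unset Printing Implicit Defensive.

Import Order.TTheory GRing.Theory Num.Theory.
Import numFieldNormedType.Exports.

Local Open Scope classical_set_scope.
Local Open Scope ring_scope.

(** This is a maximum principle for the averaging operator with kernel [J],
    propagated forward in time. Let [M] be the supremum of [|w|] over the
    initial slab [0 <= t <= alpha].

    The Lebesgue measure of a hyperplane is zero and [J] vanishes for negative
    times, so [J] has little mass near time zero: some [d > 0] satisfies
    [theta = \int_{t <= d} J < 1] ([small_mass]). This also gives
    [0 <= alpha], so the initial slab is not empty.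

    Suppose [|w| <= M] up to some time [T >= alpha], and let [S] be the
    supremum of [|w|] up to time [T + d]. For [T < t <= T + d] the value
    [w(x, t)] is an average of [w(y, s)] over [s <= t], because [J] lives in
    nonnegative times. The part of the average with [s <= T] only sees values
    bounded by [M]; the part with [T < s] has weight at most [theta], because
    [t - s < d] there, and sees values bounded by [S]. Hence
    [|w(x, t)| <= M + theta (S - M)] ([convolution_bound]). If [S > M], taking
    the supremum gives [S - M <= theta (S - M)], which is absurd. So the bound
    [M] extends to time [T + d] ([bound_extends]), and steps of the fixed
    length [d] starting from [alpha] exhaust the half-space.

    The weights are computed by the change of variables [z |-> a - z]. Its
    effect on the completed Lebesgue measure of [R^n x R] comes from the
    uniqueness of Lebesgue measure on [R], then from the uniqueness of product
    measures, and finally passes to the outer measure and its Caratheodory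
    sets ([measure_preserving_reflect]). *)

(** * Reflections preserve Lebesgue measure *)

Definition measure_preserving d (T : measurableType d) (R : realType)
    (m : set T -> \bar R) (f : T -> T) :=
  measurable_fun setT f /\ forall A, measurable A -> m (f @^-1` A) = m A.

(** The image of [m1 \x m2] under [(f, g)] agrees with [m1 \x m2] on rectangles,
    hence everywhere, by uniqueness of the product measure. *)
Lemma measure_preserving_prod d1 d2 (T1 : measurableType d1)
    (T2 : measurableType d2) (R : realType)
    (m1 : {sigma_finite_measure set T1 -> \bar R})
    (m2 : {sigma_finite_measure set T2 -> \bar R})
    (f : T1 -> T1) (g : T2 -> T2) :
  measure_preserving m1 f -> measure_preserving m2 g ->
  measure_preserving (m1 \x m2)%E (fun z => (f z.1, g z.2)).
Proof.
move=> [mf pf] [mg pg].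
have mfg : measurable_fun setT (fun z : T1 * T2 => (f z.1, g z.2)).
  apply: measurable_fun_pair.
    exact: (measurableT_comp mf measurable_fst).
  exact: (measurableT_comp mg measurable_snd).
split=> // X mX.
pose h : {mfun (T1 * T2)%type >-> (T1 * T2)%type} :=
  HB.pack (fun z : T1 * T2 => (f z.1, g z.2))
    (isMeasurableFun.Build _ _ _ _ _ mfg).
apply/esym.
have := @product_measure_unique _ _ T1 T2 R m1 m2 (pushforward (m1 \x m2)%E h).
apply => // A B mA mB; rewrite /pushforward.
rewrite -pf// -pg// -product_measure1E//.
- by rewrite -[X in measurable X]setTI; exact: mf.
- by rewrite -[X in measurable X]setTI; exact: mg.
Qed.

Lemma measure_preserving_reflect_R (R : realType) (a : R) :
  measure_preserving lebesgue_measure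
    (fun x : measurableTypeR R => (a - x : measurableTypeR R)).
Proof.
pose r (x : measurableTypeR R) : measurableTypeR R := a - x.
have mr : measurable_fun setT r by exact: measurable_funB.
split=> // A mA; rewrite -/r.
pose h : {mfun measurableTypeR R >-> measurableTypeR R} :=
  HB.pack r (isMeasurableFun.Build _ _ _ _ _ mr).
apply/esym.
have := @lebesgue_measure_unique R (pushforward lebesgue_measure h).
apply => // _ [[b c]] _ <-.
rewrite [RHS](_ : _ = lebesgue_measure (r @^-1` `]b, c]%classic))//.
rewrite (_ : _ @^-1` _ = `[a - c, a - b[%classic); last first.
  by apply/seteqP; split => x /=; rewrite /r !in_itv/=; lra.
rewrite !lebesgue_measure_itv/= !lte_fin ltrD2l ltrN2.
by case: ifP => // _; rewrite -!EFinB; congr EFin; lra.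
Qed.

(** Splitting off the first coordinate writes the reflection of [R^(n+1)] as a
    product of reflections of [R] and [R^n]. *)
Lemma measure_preserving_reflect_rV (R : realType) n (a : 'rV[R]_n) :
  measure_preserving (lebesgue_rV n)
    (fun v : 'rV[measurableTypeR R]_n => a - v).
Proof.
elim: n a => [|n IH] a.
  split=> [|A mA].
    by apply: measurable_fun_rVP => -[].
  rewrite (_ : _ @^-1` A = A)//; apply/seteqP; split=> v /=;
    by rewrite (thinmx0 (a - v)) (thinmx0 v).
have mr : measurable_fun setT (fun v : 'rV[measurableTypeR R]_n.+1 =>
    (a - v : 'rV[measurableTypeR R]_n.+1)).
  apply: measurable_fun_rVP => i.
  rewrite (_ : (fun _ => _) =
      (fun x : measurableTypeR R => (a ord0 i - x : measurableTypeR R))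
      \o (fun v : 'rV[measurableTypeR R]_n.+1 => v ord0 i)).
    apply: measurableT_comp; last exact: measurable_coord_rV.
    exact: (measure_preserving_reflect_R _).1.
  by apply/funext => v; rewrite /= !mxE.
split=> // A mA.
rewrite /= /lebesgue_rV_step /pushforward.
have mA' : measurable (@cons_rV R n @^-1` A).
  by rewrite -[X in measurable X]setTI; exact: measurable_cons_rV.
have [_ H] := measure_preserving_prod
  (measure_preserving_reflect_R (a ord0 ord0)) (IH (rsubmx (a : 'rV_(1 + n)))).
have E p :
    cons_rV (a ord0 ord0 - p.1, rsubmx (a : 'rV_(1 + n)) - p.2) = a - cons_rV p.
  have subE (u v : 'rV[R]_n.+1) i : (u - v) ord0 i = u ord0 i - v ord0 i.
    by rewrite !mxE.
  apply/rowP => i; rewrite subE; case: (unliftP ord0 i) => [j|] ->.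
    by rewrite !cons_rVS/= !mxE; congr (a _ _ - _); exact/val_inj.
  by rewrite !cons_rV0.
rewrite -(H _ mA'); congr (lebesgue_measure \x _)%E.
by apply/seteqP; split=> p /=; rewrite E.
Qed.

Section completion.
Context d (T : measurableType d) (R : realType).
Context (m : {measure set T -> \bar R}) (f : T -> T).
Hypotheses (pf : measure_preserving m f) (fK : involutive f).

(** The preimage of a measurable cover is a measurable cover with the same
    total measure, so outer measure does not increase under preimage; applying
    this twice gives equality because [f] is its own inverse. *)
Lemma mu_ext_preimage X : mu_ext m (f @^-1` X) = mu_ext m X.
Proof.
have le Y : (mu_ext m (f @^-1` Y) <= mu_ext m Y)%E.
  apply: le_ereal_inf_tmp => _ [F [mF YF] <-].
  apply: ereal_inf_lbound; exists (fun k => f @^-1` F k).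
    split=> [k|]; first by rewrite -[X in measurable X]setTI; exact: pf.1.
    by rewrite -preimage_bigcup; exact: preimage_subset.
  by apply: eq_eseriesr => k _; exact: pf.2.
have fXX : f @^-1` (f @^-1` X) = X by apply/seteqP; split=> x /=; rewrite fK.
by apply/eqP; rewrite eq_le le /= -[X in (mu_ext m X <= _)%E]fXX le.
Qed.

(** Splitting [X] along the preimage of [A] is the preimage of splitting
    [f @^-1` X] along [A], so [f] preserves the Caratheodory sets. *)
Lemma measure_preserving_completion :
  measure_preserving (completed_measure_extension (mu := m))
    (f : caratheodory_type (mu_ext m) -> caratheodory_type (mu_ext m)).
Proof.
split=> [_ A mA|A _]; last exact: mu_ext_preimage.
rewrite setTI; move: mA.
(* The measurable sets of the completion unfold to the Caratheodory sets. *)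
change (caratheodory_measurable (mu_ext m) A ->
  caratheodory_measurable (mu_ext m) (f @^-1` A)) => mA X.
rewrite -[LHS]mu_ext_preimage mA; congr (_ + _)%E;
  rewrite -[RHS]mu_ext_preimage; congr (mu_ext _ _);
  by apply/seteqP; split=> x /=; rewrite fK.
Qed.

End completion.

Lemma measure_preserving_reflect (R : realType) n (a : 'rV[R]_n * R) :
  measure_preserving (@lebesgue_spacetime R n)
    (fun z : spacetime R n => (a.1 - z.1, a.2 - z.2) : spacetime R n).
Proof.
apply: measure_preserving_completion; last by move=> -[x t]/=; rewrite !subKr.
exact: (measure_preserving_prod (measure_preserving_reflect_rV _)
  (measure_preserving_reflect_R _)).
Qed.

(** * Integration over space-time *)

(** The weight [M + e 1_A] bounds a function that is at most [M] outside [A] and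
    at most [M + e] on [A]. *)
Lemma ge0_integral_weighted d (T : measurableType d) (R : realType)
    (mu : {measure set T -> \bar R}) (f : T -> R) (A : set T) (M e : R) :
  measurable A -> measurable_fun setT f -> (forall z, 0 <= f z) ->
  0 <= M -> 0 <= e ->
  let G z := (M%:E * (f z)%:E + e%:E * ((EFin \o f) \_ A) z)%E in
  [/\ measurable_fun setT G, forall z, (0 <= G z)%E &
    (\int[mu]_z G z =
      M%:E * \int[mu]_z (f z)%:E + e%:E * \int[mu]_(z in A) (f z)%:E)%E].
Proof.
move=> mA mf f0 M0 e0 G.
have mfE : measurable_fun setT (EFin \o f) by exact/measurable_EFinP.
have mfA : measurable_fun setT ((EFin \o f) \_ A).
  by apply/(measurable_restrictT _ mA); exact: measurable_funTS.
have fA0 z : (0 <= ((EFin \o f) \_ A) z)%E.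
  by apply: erestrict_ge0 => y _; rewrite lee_fin.
have f0E z : (0 <= (f z)%:E)%E by rewrite lee_fin.
split.
- by apply: emeasurable_funD; exact: measurable_funeM.
- by move=> z; rewrite adde_ge0// mule_ge0// lee_fin.
rewrite ge0_integralD//; [|by move=> z _; rewrite mule_ge0
  |exact: measurable_funeM|by move=> z _; rewrite mule_ge0
  |exact: measurable_funeM].
by rewrite !ge0_integralZl_EFin// [in RHS](integral_mkcond A).
Qed.

Lemma abse_integral_le_dominated d (T : measurableType d) (R : realType)
    (mu : {measure set T -> \bar R}) (D : set T) (k w : T -> R)
    (G : T -> \bar R) :
  measurable D -> measurable_fun setT k -> measurable_fun D w ->
  measurable_fun setT G -> (forall y, (0 <= G y)%E) ->
  (forall y, D y -> (`|k y * w y|%:E <= G y)%E) ->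
  (`|\int[mu]_(y in D) (k y * w y)%:E| <= \int[mu]_y G y)%E.
Proof.
move=> mD mk mw mG G0 kwG.
have mkw : measurable_fun D (fun y => (k y * w y)%:E).
  by apply/measurable_EFinP/measurable_funM => //; exact: measurable_funTS.
apply: (le_trans (le_abse_integral mu mD mkw)).
apply: (@le_trans _ _ (\int[mu]_(y in D) G y)%E); last first.
  by apply: ge0_subset_integral.
apply: ge0_le_integral => //.
- exact: measurableT_comp.
- exact: measurable_funTS.
Qed.

Section spacetime.
Context (R : realType) (n : nat).
Local Notation mu := (@lebesgue_spacetime R n).

Let slab_preimage (B : set R) : [set z : 'rV[R]_n * R | B z.2] = setT `*` B.
Proof. by apply/seteqP; split=> [[x t]|[x t] []]. Qed.

Lemma measurable_slab (B : set (measurableTypeR R)) : measurable B ->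
  measurable ([set z | B z.2] : set (spacetime R n)).
Proof.
move=> mB; apply: caratheodory_measurable_mu_ext; rewrite slab_preimage.
exact: measurableX.
Qed.

Lemma measurable_time_le (b : R) :
  measurable ([set z | z.2 <= b] : set (spacetime R n)).
Proof.
have := @measurable_slab `]-oo, b]%classic (measurable_itv _).
by congr measurable; apply/seteqP; split=> z /=; rewrite in_itv.
Qed.

Lemma measurable_time_gt (b : R) :
  measurable ([set z | b < z.2] : set (spacetime R n)).
Proof.
have := @measurable_slab `]b, +oo[%classic (measurable_itv _).
by congr measurable; apply/seteqP; split=> z /=; rewrite in_itv/= andbT.
Qed.

Lemma measurable_halfspace : measurable (halfspace : set (spacetime R n)).
Proof.
have := @measurable_slab `[0, +oo[%classic (measurable_itv _).
by congr measurable; apply/seteqP; split=> z /=; rewrite in_itv/= andbT.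
Qed.

Lemma lebesgue_spacetime_slice (t : R) : mu [set z | z.2 = t] = 0%E.
Proof.
have mt : measurable ([set t] : set (measurableTypeR R)).
  exact: measurable_set1.
have -> : [set z : spacetime R n | z.2 = t] = setT `*` [set t].
  exact: slab_preimage.
rewrite [LHS]measurable_mu_extE; last exact: measurableX.
rewrite [LHS]product_measure1E//.
by rewrite (_ : _ [set t] = 0%E) ?mule0//; exact: lebesgue_measure_set1.
Qed.

Lemma integral_reflect (f : 'rV[R]_n * R -> \bar R) (a : 'rV[R]_n * R) :
  measurable_fun setT (f : spacetime R n -> \bar R) -> (forall z, 0 <= f z)%E ->
  (\int[mu]_z f (a.1 - z.1, a.2 - z.2)%R = \int[mu]_z f z)%E.
Proof.
move=> mf f0; have [mr pr] := measure_preserving_reflect a.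
have := @ge0_integral_pushforward _ _ _ _ R _ mr mu setT f measurableT mf.
rewrite preimage_setT => <- //.
by apply: eq_measure_integral => A mA _; exact: pr.
Qed.

(** * Propagation of a bound forward in time *)

Section kernel.
Variable (J : 'rV[R]_n * R -> R).
Hypotheses (mJ : measurable_fun setT (J : spacetime R n -> R))
  (J_ge0 : forall z, 0 <= J z) (J_past : forall z, z.2 < 0 -> J z = 0)
  (int_J : (\int[mu]_z (J z)%:E = 1)%E).

Let mJE (D : set (spacetime R n)) :
  measurable_fun D (EFin \o J : spacetime R n -> \bar R).
Proof. by apply: measurable_funTS; apply/measurable_EFinP. Qed.

(** The mass of [J] sits in [t > 0], since [t < 0] is outside the support and
    [t = 0] is a null set. By monotone convergence some region [t > 1/(k+1)]
    already carries positive mass, so its complement carries less than [1]. *)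
Lemma small_mass : exists2 d : R, 0 < d &
  (\int[mu]_(z in [set z | (z.2 <= d)%R]) (J z)%:E < 1)%E.
Proof.
pose F k : set (spacetime R n) := [set z | k.+1%:R^-1 < z.2].
have mF k : measurable (F k) by exact: measurable_time_gt.
have ndF : nondecreasing_seq F.
  move=> i j ij; apply/subsetPset => z /=; apply: le_lt_trans.
  by rewrite lef_pV2 ?posrE ?ltr0n// ler_nat.
have UF : \bigcup_k F k = [set z | 0 < z.2].
  apply/seteqP; split=> [z [k _]|z /= z0].
    by apply: lt_trans; rewrite invr_gt0.
  exists (Num.truncn z.2^-1) => //=.
  by rewrite /F/= invf_plt ?posrE// truncnS_gt.
have cvgF := @ge0_nondecreasing_set_cvg_integral _ _ R F (EFin \o J) mu ndF mF
  (fun k => @mJE _) (fun k z _ => J_ge0 z).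
have int_pos : (\int[mu]_(z in \bigcup_k F k) (J z)%:E = 1)%E.
  rewrite UF -int_J.
  rewrite [RHS](@ge0_negligible_integral _ _ _ mu _ [set z | z.2 = 0])//.
  - rewrite [LHS]integral_mkcond [RHS]integral_mkcond.
    apply: eq_integral => z _.
    rewrite /patch /=; have [z0|z0|z0] := ltgtP z.2 0.
    + by rewrite J_past//; do 2 case: ifP.
    + by rewrite !mem_set//=; split => // z0'; rewrite z0' ltxx in z0.
    + by rewrite !memNset//=; [case|rewrite z0 ltxx].
  - exact: (@measurable_slab [set 0]).
  - by move=> z _; rewrite lee_fin.
  - exact: lebesgue_spacetime_slice.
have [k Fk] : exists k, (0 < \int[mu]_(z in F k) (J z)%:E)%E.
  apply: contrapT => /forallNP F0.
  move: cvgF; rewrite int_pos (_ : (fun _ => _) = cst 0%E); last first.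
    apply/funext => k; apply/eqP; rewrite eq_le leNgt; apply/andP; split.
      exact/negP.
    by apply: integral_ge0 => z _; rewrite lee_fin.
  by move=> /(cvg_unique (@ereal_hausdorff R) (cvg_cst _))/eqP;
    rewrite eqe eq_sym oner_eq0.
exists (k.+1%:R^-1); first by rewrite invr_gt0.
rewrite -int_J.
rewrite -[X in (_ < \int[mu]_(z in X) _)%E](setUv [set z | z.2 <= k.+1%:R^-1]).
have FE : ~` [set z | z.2 <= k.+1%:R^-1] = F k.
  by apply/seteqP; split=> z /=; rewrite /F/= ltNge => /negP.
have mk := @measurable_time_le (k.+1%:R^-1).
rewrite FE ge0_integral_setU//.
- rewrite lteDl// ge0_fin_numE; last first.
    by apply: integral_ge0 => z _; rewrite lee_fin.
  apply: (@le_lt_trans _ _ (\int[mu]_z (J z)%:E)%E); last by rewrite int_J ltry.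
  by apply: ge0_subset_integral => // z _; rewrite lee_fin.
- by move=> z _; rewrite lee_fin.
- by rewrite -FE; exact/disj_setPCl.
Qed.

(** The integrand is dominated by the reflection of
    [M J + e J 1_{t <= d}]: at a point [y] of time at most [T] the first term
    suffices; if the time of [y] is between [T] and that of [z], then [z - y]
    has time at most [d], so both terms are present; after the time of [z] the
    kernel vanishes. *)
Lemma convolution_bound (w : 'rV[R]_n * R -> R) (M e T d : R)
    (z : 'rV[R]_n * R) :
  lebesgue_measurable halfspace w -> 0 <= M -> 0 <= e -> z.2 <= T + d ->
  (forall y, 0 <= y.2 <= T -> `|w y| <= M) ->
  (forall y, 0 <= y.2 <= T + d -> `|w y| <= M + e) ->
  (`|\int[mu]_(y in halfspace) (J (z.1 - y.1, z.2 - y.2) * w y)%:E| <=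
   M%:E + e%:E * \int[mu]_(y in [set y | (y.2 <= d)%R]) (J y)%:E)%E.
Proof.
move=> mw M0 e0 zT wM wMe.
have mJr : measurable_fun setT
    (fun y : spacetime R n => J (z.1 - y.1, z.2 - y.2)).
  exact: (measurableT_comp mJ (measure_preserving_reflect z).1).
have [] := ge0_integral_weighted mu (measurable_time_le d) mJ J_ge0 M0 e0.
set G := (fun y : spacetime R n => _) => mG G0 intG.
rewrite int_J mule1 in intG.
rewrite -intG -(integral_reflect z mG G0).
have mGr : measurable_fun setT
    (fun y : spacetime R n => G (z.1 - y.1, z.2 - y.2)).
  exact: (measurableT_comp mG (measure_preserving_reflect z).1).
apply: (abse_integral_le_dominated mu measurable_halfspace mJr mw mGr) => [y|].
  exact: G0.
move=> y y0; rewrite /G /patch /= normrM ger0_norm//.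
set j := J _; have j0 : 0 <= j by exact: J_ge0.
have [yz|zy] := leP y.2 z.2; last first.
  by rewrite /j J_past ?subr_lt0//= mul0r; case: ifP => _; rewrite !mule0 adde0.
have [yT|Ty] := leP y.2 T.
  apply: (@le_trans _ _ (M%:E * j%:E)%E).
    by rewrite -EFinM lee_fin mulrC ler_wpM2r// wM// y0 yT.
  by rewrite leeDl// mule_ge0//; case: ifP => _ //; rewrite ?lee_fin.
rewrite ifT; last by apply/mem_set => /=; lra.
rewrite -!EFinM -EFinD lee_fin -mulrDl mulrC ler_wpM2r// wMe// y0/=; lra.
Qed.

(** The supremum [S] of [|w|] up to time [T + d] satisfies
    [S <= M + theta (S - M)] with [theta < 1], which excludes [M < S]. The
    a priori bound [K] makes [S] finite, so that [S - M] can be absorbed. *)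
Lemma bound_extends (w : 'rV[R]_n * R -> R) (K M T d : R) :
  lebesgue_measurable halfspace w -> (forall z, 0 <= z.2 -> `|w z| <= K) ->
  0 <= M -> 0 <= T -> 0 <= d ->
  (\int[mu]_(z in [set z | (z.2 <= d)%R]) (J z)%:E < 1)%E ->
  (forall z : 'rV[R]_n * R, T <= z.2 -> (w z)%:E =
    (\int[mu]_(y in halfspace) (J (z.1 - y.1, z.2 - y.2) * w y)%:E)%E) ->
  (forall z, 0 <= z.2 <= T -> `|w z| <= M) ->
  forall z, 0 <= z.2 <= T + d -> `|w z| <= M.
Proof.
move=> mw wK M0 T0 d0 mass_lt1 w_eq wM.
pose S := sup [set `|w z| | z in [set z : 'rV[R]_n * R | 0 <= z.2 <= T + d]].
have wS z : 0 <= z.2 <= T + d -> `|w z| <= S.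
  move=> zTd; apply: ub_le_sup; last by exists z.
  by exists K => _ [y /= /andP[y0 _] <-]; exact: wK.
have [SM z /wS /le_trans->//|MS] := leP S M.
pose th := fine (\int[mu]_(z in [set z | (z.2 <= d)%R]) (J z)%:E)%E.
have thE : (\int[mu]_(z in [set z | (z.2 <= d)%R]) (J z)%:E)%E = th%:E.
  rewrite fineK// ge0_fin_numE ?(lt_le_trans mass_lt1) ?leey//.
  by apply: integral_ge0 => z _; rewrite lee_fin.
have th1 : th < 1 by rewrite -lte_fin -thE.
have th0 : 0 <= th.
  by rewrite -lee_fin -thE; apply: integral_ge0 => z _; rewrite lee_fin.
have e0 : 0 < S - M by rewrite subr_gt0.
suff : S <= M + (S - M) * th by move=> ?; exfalso; nra.
apply: ge_sup; first by exists `|w 0|; exists 0 => //=; rewrite lexx addr_ge0.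
move=> _ [z /= zTd <-]; have /andP[z0 zT'] := zTd.
have [zT|Tz] := leP z.2 T.
  by apply: (le_trans (wM z _)); [rewrite z0|rewrite lerDl mulr_ge0// ltW].
rewrite -lee_fin EFinD EFinM -thE -abse_EFin w_eq; last exact: ltW.
by apply: (convolution_bound mw M0 (ltW e0) zT' wM) => y /wS;
  rewrite subrKC.
Qed.

End kernel.
End spacetime.

Lemma vanishes_in_past (R : realType) n (J : 'rV[R]_n * R -> R) :
  supp J `<=` halfspace -> forall z, z.2 < 0 -> J z = 0.
Proof.
move=> sJ z z0; apply/eqP; apply: contraLR z0 => Jz; rewrite -leNgt.
by apply: sJ; exact: subset_closure.
Qed.

(** If the set defining [alpha J] is unbounded, its real supremum is [0] by
    convention; otherwise [alpha J] bounds [d]. *)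
Lemma alpha_ge0 (R : realType) n (J : 'rV[R]_n * R -> R) (d : R) :
  0 <= d ->
  (\int[@lebesgue_spacetime R n]_(z in [set z | (z.2 <= d)%R])
    (J z)%:E < 1)%E ->
  0 <= alpha J.
Proof.
move=> d0 Jd; rewrite /alpha; set A := [set b | _].
have [hA|/sup_out ->//] := pselect (has_sup A).
by apply: (le_trans d0); apply: ub_le_sup => //; case: hA.
Qed.

Theorem theorem3 (R : realType) (n : nat) (J w : 'rV[R]_n * R -> R)
  (supp_J : supp J `<=` halfspace)
  (J_ge0 : forall z, 0 <= J z)
  (J_L1 : (@lebesgue_spacetime R n).-integrable setT (EFin \o J))
  (int_J : (\int[@lebesgue_spacetime R n]_z (J z)%:E = 1)%E)
  (compact_J : compact (supp J))
  (measurable_w : lebesgue_measurable halfspace w)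
  (bounded_w : [bounded w z | z in halfspace])
  (w_eq : forall (x : 'rV[R]_n) (t : R), alpha J <= t ->
     (w (x, t))%:E = (\int[@lebesgue_spacetime R n]_(z in halfspace)
                        (J (x - z.1, t - z.2) * w z)%:E)%E) :
  sup [set `|w z| | z in halfspace]
  = sup [set `|w z| | z in [set z : 'rV[R]_n * R | 0 <= z.2 <= alpha J]].
Proof.
have J_past := vanishes_in_past supp_J.
have mJ : measurable_fun setT (J : spacetime R n -> R).
  by apply/measurable_EFinP; exact: measurable_int J_L1.
have [d d0 mass_d] := small_mass mJ J_ge0 J_past int_J.
have a0 := alpha_ge0 (ltW d0) mass_d.
have [K wK] : exists K, forall z, 0 <= z.2 -> `|w z| <= K.
  have [K [_ wK]] := bounded_w.
  by exists (K + 1) => z z0; apply: wK => //; rewrite ltrDl.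
set M := sup [set _ | _ in [set z | 0 <= _ <= _]].
have wM z : 0 <= z.2 <= alpha J -> `|w z| <= M.
  move=> zTd; apply: ub_le_sup; last by exists z.
  by exists K => _ [y /= /andP[y0 _] <-]; exact: wK.
have M0 : 0 <= M by apply: le_trans (wM 0 _); rewrite //= lexx.
have slabs k z : 0 <= z.2 <= alpha J + d *+ k -> `|w z| <= M.
  elim: k z => [|k IH] z; first by rewrite mulr0n addr0; exact: wM.
  have adk : alpha J <= alpha J + d *+ k by rewrite lerDl mulrn_wge0// ltW.
  rewrite mulrSr addrA.
  have T0 := le_trans a0 adk.
  apply: (bound_extends mJ J_ge0 J_past int_J measurable_w wK M0 T0 (ltW d0)
    mass_d _ IH).
  by move=> [x t] /(le_trans adk); exact: w_eq.
apply/eqP; rewrite eq_le; apply/andP; split.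
  apply: ge_sup; first by exists `|w 0|; exists 0 => //=; rewrite /halfspace/=.
  move=> _ [z /= z0 <-]; apply: (slabs (Num.truncn (z.2 / d)).+1).
  rewrite [0 <= _]z0/= -[leLHS]add0r lerD// -mulr_natl -ler_pdivrMr//.
  exact/ltW/truncnS_gt.
apply: ge_sup; first by exists `|w 0|; exists 0 => //=; rewrite lexx.
move=> _ [z /= /andP[z0 _] <-]; apply: ub_le_sup; last by exists z.
by exists K => _ [y y0 <-]; exact: wK.
Qed.
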